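(* Let $\phi:V_1\rightarrow V_2$ be an algebraic epimorphism of quasi-Lie schemes from $S(W_1,V_1)$ on $N$ to $S(W_2,V_2)$ on $N'$, and let $\Phi:G_{W_1}\to G_{W_2}$ be the induced Lie group epimorphism. If $X\in\mathcal{V}_1$ is such that $g_{1\bigstar}X=0$ for a certain curve $g_1$ in $G_{W_1}$, then $\Phi(g_1)_{\bigstar}\,\phi(X)=0$, where $\phi(X)$ is the $t$-dependent vector field given by $[\phi(X)]_t=\phi(X_t)$ for all $t\in\mathbb{R}$.
   Context: All objects are smooth. A quasi-Lie scheme $S(W,V)$ on a manifold $N$ consists of finite-dimensional real vector spaces $W,V$ of vector fields on $N$ with $[W,W]\subset W\subset V$ and $[W,V]\subset V$. $\mathcal{V}$ denotes the family of $t$-dependent vector fields $X=\{X_t\}_{t\in\mathbb{R}}$ with $X_t\in V$ for all $t$. $G_W$ denotes the simply connected Lie group with Lie algebra $T_eG_W\simeq W$ acting on $N$ so that the Lie algebra of fundamental vector fields of the action is $W$ (all actions are assumed to be globally defined). A curve $g:t\in\mathbb{R}\mapsto g_t\in G_W$ acts on $t$-dependent vector fields by $$(g_{\bigstar}X)_t=\frac{\partial g_t}{\partial t}\circ g_t^{-1}+g_{t*}X_t,$$ where $g_t$ also denotes the diffeomorphism of $N$ given by the action of $g_t$. An algebraic quasi-Lie schemes morphism between $S(W_1,V_1)$ and $S(W_2,V_2)$ is a linear map $\phi:V_1\to V_2$ such that $[\phi(X_1),\phi(Y_1)]=\phi([X_1,Y_1])$ for all $X_1\in W_1$, $Y_1\in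 V_1$, and $\phi(W_1)\subset W_2$. It is an algebraic epimorphism if $\phi(W_1)=W_2$ and $\phi(V_1)=V_2$. In that case $\phi|_{W_1}:W_1\to W_2$ is a Lie algebra epimorphism, and $\Phi:G_{W_1}\to G_{W_2}$ denotes the unique Lie group epimorphism with $\Phi\circ\exp=\exp\circ\,\phi|_{W_1}$ (under the identifications of $W_i$ with the Lie algebra of $G_{W_i}$). $\Phi(g_1)$ is the curve $t\mapsto\Phi((g_1)_t)$. *)

(* Defs.v *)
From HB Require Import structures.
From mathcomp Require Import all_boot all_order all_algebra.
From mathcomp Require Import all_classical all_reals all_analysis.

Set Implicit Arguments.
Unset Strict Implicit.
Unset Printing Implicit Defensive.

Import Order.TTheory GRing.Theory Num.Theory.
Import numFieldNormedType.Exports.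

Local Open Scope classical_set_scope.
Local Open Scope ring_scope.

(* [f] is of class C^k on the set [U], which is meant to be open: [f] is
   differentiable on [U] and its directional derivatives are of class C^(k-1).
   For finite-dimensional [E] (the only case used below) this is the usual
   notion; the values of [f] outside [U] are irrelevant. *)
Fixpoint class_C (R : realType) (E F : normedModType R) (k : nat) (U : set E)
    (f : E -> F) : Prop :=
  match k with
  | 0 => forall x, U x -> {for x, continuous f}
  | k'.+1 => (forall x, U x -> differentiable f x)
             /\ forall v : E, class_C k' U (fun x => 'D_v f x)
  end.

Definition smooth_on (R : realType) (E F : normedModType R) (U : set E)
    (f : E -> F) : Prop :=
  forall k, class_C k U f.

(* A chart is given by an open domain, the coordinate map and its inverse; both
   maps are total functions whose values outside [chart_dom], respectively
   outside [chart_img], are irrelevant. *)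
Record chart (R : realType) (E : normedModType R) (T : topologicalType) := Chart {
  chart_dom : set T;
  coord : T -> E;
  param : E -> T }.

Definition chart_img (R : realType) (E : normedModType R) (T : topologicalType)
    (c : chart E T) : set E :=
  coord c @` chart_dom c.

Definition is_chart (R : realType) (E : normedModType R) (T : topologicalType)
    (c : chart E T) : Prop :=
  [/\ open (chart_dom c), open (chart_img c),
      (forall x, chart_dom c x -> param c (coord c x) = x),
      (forall x, chart_dom c x -> {for x, continuous (coord c)})
    & (forall u, chart_img c u -> {for u, continuous (param c)})].

Definition smooth_map (R : realType) (E E' : normedModType R)
    (T T' : topologicalType) (A : set (chart E T)) (A' : set (chart E' T'))
    (f : T -> T') : Prop :=
  continuous f /\
  forall c c', A c -> A' c' ->
    smooth_on [set u | chart_img c u /\ chart_dom c' (f (param c u))]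
              (fun u => coord c' (f (param c u))).

Definition vect_atlas (R : realType) (E : normedModType R) : set (chart E E) :=
  [set Chart setT id id].

Definition prod_atlas (R : realType) (E E' : normedModType R)
    (T T' : topologicalType) (A : set (chart E T)) (A' : set (chart E' T')) :
    set (chart (E * E')%type (T * T')%type) :=
  [set c | exists a a', [/\ A a, A' a' &
     c = Chart (chart_dom a `*` chart_dom a')
               (fun x => (coord a x.1, coord a' x.2))
               (fun u => (param a u.1, param a' u.2))]].

(* An n-dimensional smooth manifold. The atlas need not be maximal: it
   determines the smooth structure. *)
HB.mixin Record Topological_isManifold (R : realType) (n : nat) M
    of Topological M := {
  atlas : set (chart 'rV[R]_n M);
  atlas_chart : forall c, atlas c -> is_chart c;
  atlas_cover : forall x : M, exists2 c, atlas c & chart_dom c x;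
  atlas_compat : forall c c', atlas c -> atlas c' ->
    smooth_on [set u | chart_img c u /\ chart_dom c' (param c u)]
              (fun u => coord c' (param c u));
  manifold_hausdorff : hausdorff_space M;
  manifold_second_countable : @second_countable M }.

#[short(type="manifoldType")]
HB.structure Definition Manifold (R : realType) (n : nat) :=
  {M of Topological_isManifold R n M & Topological M}.

HB.mixin Record Manifold_Group_isLieGroup (R : realType) (n : nat) G
    of Manifold R n G & Group G := {
  lie_mul_smooth :
    smooth_map (prod_atlas (@atlas R n G) (@atlas R n G)) (@atlas R n G)
      (fun p : G * G => (p.1 * p.2)%g);
  lie_inv_smooth :
    smooth_map (@atlas R n G) (@atlas R n G) (fun g : G => (g^-1)%g) }.

#[short(type="lieGroupType")]
HB.structure Definition LieGroup (R : realType) (n : nat) :=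
  {G of Manifold R n G & Group G & Manifold_Group_isLieGroup R n G}.

Definition simply_connected (R : realType) (T : topologicalType) : Prop :=
  (forall x y : T, exists gamma : R -> T,
     [/\ {within `[0, 1], continuous gamma}, gamma 0 = x & gamma 1 = y]) /\
  (forall gamma : R -> T, {within `[0, 1], continuous gamma} ->
     gamma 0 = gamma 1 ->
     exists H : R * R -> T,
       {within `[0, 1] `*` `[0, 1], continuous H} /\
       forall t, 0 <= t <= 1 ->
         [/\ H (0, t) = gamma t, H (1, t) = gamma 0,
             H (t, 0) = gamma 0 & H (t, 1) = gamma 0]).

Section Manifolds.
Variables (R : realType) (n : nat) (M : manifoldType R n).

Definition smooth_fun (f : M -> R) : Prop :=
  smooth_map (@atlas R n M) (@vect_atlas R R) f.

Definition smooth_curve (c : R -> M) : Prop :=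
  smooth_map (@vect_atlas R R) (@atlas R n M) c.

(* A tangent vector at [p] is a derivation at [p] of the algebra of smooth
   functions. It is represented by a function defined on all functions, set to
   0 on those that are not smooth, so that equality of tangent vectors is
   Leibniz equality and the vector space structure is the pointwise one. *)
Definition is_tangent (p : M) (v : (M -> R) -> R) : Prop :=
  [/\ (forall f, ~ smooth_fun f -> v f = 0),
      (forall (a : R) f g, smooth_fun f -> smooth_fun g ->
         v (fun x => a * f x + g x) = a * v f + v g)
    & (forall f g, smooth_fun f -> smooth_fun g ->
         v (fun x => f x * g x) = v f * g p + f p * v g)].

(* Vector fields are derivations of the algebra of smooth functions, with the
   same convention on functions that are not smooth. *)
Definition is_vfield (X : (M -> R) -> (M -> R)) : Prop :=
  [/\ (forall f, smooth_fun f -> smooth_fun (X f)),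
      (forall f, ~ smooth_fun f -> X f = 0),
      (forall (a : R) f g, smooth_fun f -> smooth_fun g ->
         X (fun x => a * f x + g x) = (fun x => a * X f x + X g x))
    & (forall f g, smooth_fun f -> smooth_fun g ->
         X (fun x => f x * g x) = (fun x => X f x * g x + f x * X g x))].

Definition vf_bracket (X Y : (M -> R) -> (M -> R)) : (M -> R) -> (M -> R) :=
  fun f => X (Y f) - Y (X f).

Definition finite_dim_vfields (V : set ((M -> R) -> (M -> R))) : Prop :=
  V `<=` is_vfield /\
  exists (d : nat) (e : 'I_d -> (M -> R) -> (M -> R)),
    V = range (fun a : 'I_d -> R => \sum_(i < d) a i *: e i).

Definition quasi_lie_scheme (W V : set ((M -> R) -> (M -> R))) : Prop :=
  [/\ finite_dim_vfields W /\ finite_dim_vfields V,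
      W `<=` V,
      (forall X Y, W X -> W Y -> W (vf_bracket X Y))
    & (forall X Y, W X -> V Y -> V (vf_bracket X Y))].

(* The t-dependent vector fields taking values in [V], with smooth dependence
   on (t, x). *)
Definition tdep_vfield (V : set ((M -> R) -> (M -> R)))
    (X : R -> (M -> R) -> (M -> R)) : Prop :=
  (forall t, V (X t)) /\
  forall f, smooth_fun f ->
    smooth_map (prod_atlas (@vect_atlas R R) (@atlas R n M)) (@vect_atlas R R)
      (fun p : R * M => X p.1 f p.2).

End Manifolds.

Section Actions.
Variables (R : realType) (m n : nat) (G : lieGroupType R m)
  (N : manifoldType R n) (act : G -> N -> N).

Definition smooth_action : Prop :=
  [/\ (forall x, act 1%g x = x),
      (forall g h x, act (g * h)%g x = act g (act h x))
    & smooth_map (prod_atlas (@atlas R m G) (@atlas R n N)) (@atlas R n N)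
        (fun p : G * N => act p.1 p.2)].

(* The fundamental vector field of [v] in T_eG: its value at [x] is the image
   of [v] under the differential at e of the orbit map g |-> g x. *)
Definition fundamental (v : (G -> R) -> R) : (N -> R) -> (N -> R) :=
  fun f x => if `[< smooth_fun f >] then v (fun g => f (act g x)) else 0.

(* [act] is an action of the simply connected group G = G_W whose Lie algebra
   of fundamental vector fields is [W], [fundamental] being the identification
   of T_eG with [W]. For the bracket on T_eG given by right-invariant vector
   fields this map is automatically a Lie algebra morphism. *)
Definition scheme_action (W : set ((N -> R) -> (N -> R))) : Prop :=
  [/\ simply_connected R G, smooth_action
    & set_bij (@is_tangent R m G 1%g) W fundamental].

(* The vector field (dg_t/dt) o g_t^-1, whose value at [x] is the velocity at
   s = t of the curve s |-> g_s (g_t^-1 x). *)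
Definition curve_velocity (g : R -> G) (t : R) : (N -> R) -> (N -> R) :=
  fun f x => if `[< smooth_fun f >]
             then derive1 (fun s : R => f (act (g s) (act (g t)^-1%g x))) t
             else 0.

Definition vf_pushforward (h : G) (X : (N -> R) -> (N -> R)) :
    (N -> R) -> (N -> R) :=
  fun f x => X (fun y => f (act h y)) (act h^-1%g x).

Definition gstar (g : R -> G) (X : R -> (N -> R) -> (N -> R)) :
    R -> (N -> R) -> (N -> R) :=
  fun t => curve_velocity g t + vf_pushforward (g t) (X t).

End Actions.

(* [e] is the exponential map of [G], i.e. s |-> e (s v) is the one-parameter
   subgroup with velocity [v] at s = 0, for every [v] in T_eG. *)
Definition exponential_map (R : realType) (m : nat) (G : lieGroupType R m)
    (e : ((G -> R) -> R) -> G) : Prop :=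
  forall v, is_tangent (1%g : G) v ->
    [/\ smooth_curve (fun s : R => e (s *: v)),
        (forall s t : R, e ((s + t) *: v) = (e (s *: v) * e (t *: v))%g)
      & (forall h, smooth_fun h -> derive1 (fun s : R => h (e (s *: v))) 0 = v h)].

Section Morphisms.
Variables (R : realType) (n1 n2 : nat)
  (N1 : manifoldType R n1) (N2 : manifoldType R n2).

(* [phi] represents a map V1 -> V2; its values outside [V1] are irrelevant. *)
Definition algebraic_morphism
    (W1 V1 : set ((N1 -> R) -> (N1 -> R)))
    (W2 V2 : set ((N2 -> R) -> (N2 -> R)))
    (phi : ((N1 -> R) -> (N1 -> R)) -> ((N2 -> R) -> (N2 -> R))) : Prop :=
  [/\ phi @` V1 `<=` V2,
      (forall (a : R) X Y, V1 X -> V1 Y -> phi (a *: X + Y) = a *: phi X + phi Y),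
      (forall X Y, W1 X -> V1 Y ->
         vf_bracket (phi X) (phi Y) = phi (vf_bracket X Y))
    & phi @` W1 `<=` W2].

Definition algebraic_epimorphism
    (W1 V1 : set ((N1 -> R) -> (N1 -> R)))
    (W2 V2 : set ((N2 -> R) -> (N2 -> R)))
    (phi : ((N1 -> R) -> (N1 -> R)) -> ((N2 -> R) -> (N2 -> R))) : Prop :=
  [/\ algebraic_morphism W1 V1 W2 V2 phi, phi @` W1 = W2 & phi @` V1 = V2].

(* [Phi] is the Lie group epimorphism induced by [phi]: Phi o exp = exp o phi,
   where [v] and [w] in the Lie algebras of the groups are identified with their
   fundamental vector fields. *)
Definition induced_epimorphism (m1 m2 : nat)
    (G1 : lieGroupType R m1) (G2 : lieGroupType R m2)
    (act1 : G1 -> N1 -> N1) (act2 : G2 -> N2 -> N2)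
    (exp1 : ((G1 -> R) -> R) -> G1) (exp2 : ((G2 -> R) -> R) -> G2)
    (phi : ((N1 -> R) -> (N1 -> R)) -> ((N2 -> R) -> (N2 -> R)))
    (Phi : G1 -> G2) : Prop :=
  [/\ smooth_map (@atlas R m1 G1) (@atlas R m2 G2) Phi,
      (forall g h, Phi (g * h)%g = (Phi g * Phi h)%g),
      range Phi = setT
    & forall v w, is_tangent (1%g : G1) v -> is_tangent (1%g : G2) w ->
        fundamental act2 w = phi (fundamental act1 v) ->
        Phi (exp1 v) = exp2 w].

End Morphisms.

(* Main.v *)
From HB Require Import structures.
Require Import Defs.
From mathcomp Require Import all_boot all_order all_algebra.
From mathcomp Require Import all_classical all_reals all_analysis.

Set Implicit Arguments.
Unset Strict Implicit.
Unset Printing Implicit Defensive.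

Import Order.TTheory GRing.Theory Num.Theory.
Import numFieldNormedType.Exports.

Local Open Scope classical_set_scope.
Local Open Scope ring_scope.

(* Let v be the logarithmic velocity g_t^-1 dg_t/dt in T_eG_1.  For every curve,
   (g_* X)_t is the push-forward by g_t of (fundamental field of v) + X_t, so
   g_* X = 0 means that X_t is minus the fundamental field of v; in particular
   X_t lies in W_1.  Differentiating Phi (exp (s v)) = exp (s phi(v)) at s = 0
   shows that dPhi sends v to phi(v), and dPhi(v) is the logarithmic velocity of
   Phi(g_t).  Hence phi(X_t) is minus the fundamental field of the logarithmic
   velocity of Phi(g_t), which is the equation Phi(g)_* phi(X) = 0. *)

Lemma near_eq_differentiable (R : numFieldType) (E F : normedModType R)
    (f g : E -> F) (x : E) :
  {near x, f =1 g} -> differentiable f x -> differentiable g x.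
Proof.
move=> fg df.
have gE : g \o shift x = cst (g x) + 'd f x +o_ 0 id.
  apply/eqaddoP => _/posnumP[e].
  have := diff_locally df; move/eqaddoP => /(_ e%:num [gt0 of e%:num]).
  apply: filter_app.
  have : \forall h \near (0 : E), f (h + x) = g (h + x).
    have : (fun h : E => h + x) @ 0 --> x.
      by rewrite -[X in _ --> X]add0r; apply: cvgD; [exact: cvg_id|exact: cvg_cst].
    by move=> /(_ _ fg).
  by apply: filter_app; near=> h => fgh; rewrite !fctE /= fgh (nbhs_singleton fg).
have dg : 'd g x = 'd f x :> (E -> F).
  by apply: diff_unique => //; exact: diff_continuous.
by apply/diff_locallyP; rewrite dg; split => //; exact: diff_continuous.
Unshelve. all: by end_near. Qed.

Lemma scale_is_bilinear (R : realType) (F : normedModType R) :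
  bilinear_for
    (GRing.Scale.Law.clone _ _ *:%R _) (GRing.Scale.Law.clone _ _ *:%R _)
    (@GRing.scale R F).
Proof.
split=> [u'|u] a x y /=.
- by rewrite scalerDl scalerA.
- by rewrite scalerDr !scalerA mulrC.
Qed.

HB.instance Definition _ (R : realType) (F : normedModType R) :=
  bilinear_isBilinear.Build R R F F _ _ (@GRing.scale R F)
  (@scale_is_bilinear R F).

Section ClassC.
Variable R : realType.
Implicit Types E F : normedModType R.

Lemma differentiable_scale E F (h : E -> R) (f : E -> F) x :
  differentiable h x -> differentiable f x ->
  differentiable (fun y => h y *: f y) x.
Proof.
move=> dh df.
apply: (@differentiable_comp _ _ _ _ (fun y => (h y, f y))
  (fun p : R * F => p.1 *: p.2)); first exact: differentiable_pair.
apply: (@differentiable_bilin _ _ _ _ (@GRing.scale R F)).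
exact: scale_continuous.
Qed.

Lemma derive_scale E F (h : E -> R) (f : E -> F) x v :
  differentiable h x -> differentiable f x ->
  'D_v (fun y => h y *: f y) x = h x *: 'D_v f x + 'D_v h x *: f x.
Proof.
move=> dh df.
rewrite !deriveE//; last exact: differentiable_scale.
rewrite (@diff_comp _ _ _ _ (fun y => (h y, f y))
  (fun p : R * F => p.1 *: p.2)) /=; last 2 first.
- exact: differentiable_pair.
- apply: (@differentiable_bilin _ _ _ _ (@GRing.scale R F)).
  exact: scale_continuous.
rewrite (@diff_bilin _ _ _ _ (@GRing.scale R F)); last first.
  exact: scale_continuous.
by rewrite diff_pair.
Qed.

Lemma class_C_congr E F k (U : set E) (f g : E -> F) :
  open U -> {in U, f =1 g} -> class_C k U f -> class_C k U g.
Proof.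
move=> oU; elim: k f g => [|k IH] f g fg; last first.
  have fgx x : U x -> {near x, f =1 g}.
    move=> Ux; apply: filterS (open_nbhs_nbhs (conj oU Ux)) => y Uy.
    by apply: fg; rewrite inE.
  move=> [df Df]; split=> [x Ux|v].
    exact: near_eq_differentiable (fgx _ Ux) (df _ Ux).
  apply: IH (Df v) => x; rewrite inE => Ux.
  exact/near_eq_derive/fgx.
move=> cf x Ux; rewrite /prop_for /continuous_at -fg ?inE//.
apply: cvg_trans (cf x Ux); apply: near_eq_cvg.
apply: filterS (open_nbhs_nbhs (conj oU Ux)) => y Uy.
by apply: fg; rewrite inE.
Qed.

Lemma class_CS E F k (U : set E) (f : E -> F) :
  class_C k.+1 U f -> class_C k U f.
Proof.
elim: k f => [|k IH] f [df Df].
  by move=> x Ux; apply: differentiable_continuous; exact: df.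
by split => // v; apply: IH.
Qed.

Lemma class_C_sub E F k (U V : set E) (f : E -> F) :
  V `<=` U -> class_C k U f -> class_C k V f.
Proof.
move=> VU; elim: k f => [|k IH] f /=; first by move=> cf x /VU; exact: cf.
by move=> [df Df]; split=> [x /VU /df//|v]; exact: IH.
Qed.

Lemma class_C_local E F k (U : set E) (f : E -> F) :
  (forall x, U x -> exists2 V, V x & class_C k V f) -> class_C k U f.
Proof.
elim: k f => [|k IH] f /= Uf; first by move=> x /Uf[V Vx]; exact.
split=> [x /Uf[V Vx [df _]]|v]; first exact: df.
by apply: IH => x /Uf[V Vx [_ Df]]; exists V.
Qed.

Lemma class_C_cst E F k (U : set E) (a : F) : class_C k U (fun=> a).
Proof.
elim: k a => [|k IH] a /=; first by move=> x _; exact: cst_continuous.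
split=> [x _|v]; first exact: differentiable_cst.
suff -> : (fun x : E => 'D_v (fun=> a) x) = fun=> 0 by exact: IH.
by apply/funext => x; exact: derive_cst.
Qed.

Lemma class_CD E F k (U : set E) (f g : E -> F) : open U ->
  class_C k U f -> class_C k U g -> class_C k U (fun x => f x + g x).
Proof.
move=> oU; elim: k f g => [|k IH] f g.
  by move=> cf cg x Ux; apply: cvgD; [exact: cf|exact: cg].
move=> [df Df] [dg Dg]; split=> [x Ux|v].
  by apply: differentiableD; [exact: df|exact: dg].
apply: class_C_congr (IH _ _ (Df v) (Dg v)) => // x; rewrite inE => Ux.
by rewrite -deriveD//; apply: diff_derivable; [exact: df|exact: dg].
Qed.

Lemma class_C_sum E F k (U : set E) n (f : 'I_n -> E -> F) : open U ->
  (forall i, class_C k U (f i)) -> class_C k U (fun x => \sum_(i < n) f i x).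
Proof.
move=> oU; elim: n f => [|n IH] f fC.
  by under eq_fun do rewrite big_ord0; exact: class_C_cst.
under eq_fun do rewrite big_ord_recl.
by apply: class_CD => //; apply: IH => i; exact: fC.
Qed.

Lemma class_C_scale E F k (U : set E) (h : E -> R) (f : E -> F) : open U ->
  class_C k U h -> class_C k U f -> class_C k U (fun x => h x *: f x).
Proof.
move=> oU; elim: k h f => [|k IH] h f.
  by move=> ch cf x Ux; apply: cvgZ; [exact: ch|exact: cf].
move=> hC fC; have [dh Dh] := hC; have [df Df] := fC; split=> [x Ux|v].
  by apply: differentiable_scale; [exact: dh|exact: df].
have : class_C k U (fun x => h x *: 'D_v f x + 'D_v h x *: f x).
  by apply: class_CD => //; apply: IH; first [exact: Df|exact: Dh|exact: class_CS].
apply: class_C_congr => // x; rewrite inE => Ux.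
by rewrite derive_scale//; [exact: dh|exact: df].
Qed.

Lemma class_C_coord E n k (U : set E) (f : E -> 'rV[R]_n) i : open U ->
  class_C k U f -> class_C k U (fun x => f x 0 i).
Proof.
move=> oU; elim: k f => [|k IH] f /=.
  move=> cf x Ux.
  apply: (@continuous_comp _ _ _ f (fun M : 'rV[R]_n => M 0 i)).
    exact: cf.
  exact: coord_continuous.
move=> [df Df]; split=> [x Ux|v].
  apply: (@differentiable_comp _ _ _ _ f (fun M : 'rV[R]_n => M 0 i)).
    exact: df.
  exact: differentiable_coord.
apply: class_C_congr (IH _ (Df v)) => // x; rewrite inE => Ux.
by rewrite derive_mx ?mxE//; apply: diff_derivable; exact: df.
Qed.

(* The middle space has to be finite-dimensional: the chain rule is written
   D_v (g o f) = \sum_i (D_v f)_i *: D_(e_i) g to reduce to products. *)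
Lemma class_C_comp E n F k (U : set E) (V : set 'rV[R]_n) (f : E -> 'rV[R]_n)
    (g : 'rV[R]_n -> F) : open U -> (forall x, U x -> V (f x)) ->
  class_C k U f -> class_C k V g -> class_C k U (fun x => g (f x)).
Proof.
move=> oU fUV; elim: k g => [|k IH] g.
  move=> cf cg x Ux; apply: (@continuous_comp _ _ _ f g); first exact: cf.
  exact/cg/fUV.
move=> fC [dg Dg]; have [df Df] := fC; split=> [x Ux|v].
  by apply: (@differentiable_comp _ _ _ _ f g); [exact: df|exact/dg/fUV].
have : class_C k U (fun x => \sum_(i < n)
    ('D_v f x) 0 i *: 'D_(delta_mx 0 i) g (f x)).
  apply: class_C_sum => // i; apply: class_C_scale => //.
    exact: class_C_coord oU (Df v).
  by apply: IH (Dg _); exact: class_CS.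
apply: class_C_congr => // x; rewrite inE => Ux.
have dfx := df x Ux; have dgx := dg _ (fUV x Ux).
rewrite [RHS]deriveE; last exact: (@differentiable_comp _ _ _ _ f g).
rewrite (@diff_comp _ _ _ _ f g)//= -(deriveE v dfx).
rewrite [in RHS](row_sum_delta ('D_v f x)) linear_sum; apply: eq_bigr => i _.
by rewrite linearZ -deriveE.
Qed.

Lemma class_C_affine E E' F k (U : set E') (i : E -> E') (di : E -> E')
    (f : E' -> F) : (forall u, is_diff u i di) ->
  (forall (h : R) u v, i (h *: v + u) = h *: di v + i u) ->
  class_C k U f -> class_C k (i @^-1` U) (fun u => f (i u)).
Proof.
move=> idi iE; elim: k f => [|k IH] f.
  move=> cf u Uu; apply: (@continuous_comp _ _ _ i f); last exact: cf.
  by apply: differentiable_continuous; apply: ex_diff; exact: idi.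
move=> [df Df]; split=> [u Uu|v].
  apply: (@differentiable_comp _ _ _ _ i f).
    by apply: ex_diff; exact: idi.
  exact: df.
suff -> : (fun u => 'D_v (fun w => f (i w)) u) = fun u => 'D_(di v) f (i u).
  by have := IH _ (Df (di v)).
apply/funext => u; rewrite /derive.
suff -> : (fun h : R => h^-1 *: (((fun w => f (i w)) \o shift u) (h *: v) - f (i u)))
  = fun h => h^-1 *: ((f \o shift (i u)) (h *: di v) - f (i u)) by [].
by apply/funext => h /=; rewrite iE.
Qed.

End ClassC.

Section SmoothMaps.
Variable R : realType.
Implicit Types E : normedModType R.

Lemma open_chart_preimage E (T T' : topologicalType) (c : chart E T)
    (f : T -> T') (B : set T') :
  is_chart c -> continuous f -> open B ->
  open [set u | chart_img c u /\ B (f (param c u))].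
Proof.
move=> [_ oc _ _ pc] cf oB; rewrite openE => u [cu Bu]; apply: filterI.
  exact: open_nbhs_nbhs.
have : {for u, continuous (f \o param c)}.
  by apply: continuous_comp; [exact: pc|exact: cf].
by apply; exact: open_nbhs_nbhs.
Qed.

Lemma is_chart_id E : is_chart (Chart setT id id : chart E E).
Proof.
split=> //=; [exact: openT| |by move=> x _; exact: cvg_id|by move=> x _; exact: cvg_id].
by rewrite /chart_img /= image_id; exact: openT.
Qed.

Lemma vect_atlas_chart E (c : chart E E) : @vect_atlas R E c -> is_chart c.
Proof. by move=> ->; exact: is_chart_id. Qed.

Lemma smooth_map_comp E E' n (T T' : topologicalType) (M : manifoldType R n)
    (A : set (chart E T)) (A' : set (chart E' T')) (f : T -> M) (g : M -> T') :
  (forall c, A c -> is_chart c) -> (forall c, A' c -> is_chart c) ->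
  smooth_map A (@atlas R n M) f -> smooth_map (@atlas R n M) A' g ->
  smooth_map A A' (fun x => g (f x)).
Proof.
move=> Ac A'c [cf sf] [cg sg].
have cgf : continuous (fun x => g (f x)).
  by move=> x; apply: (@continuous_comp _ _ _ f g); [exact: cf|exact: cg].
split=> // c c' cA cA' k; apply: class_C_local => u0 [cu0 c'u0].
have [d dA du0] := atlas_cover (f (param c u0)).
have [odom _ dK _ _] := atlas_chart _ dA.
have [oc' _ _ _ _] := A'c _ cA'.
pose U := [set u | chart_img c u /\ chart_dom c' (g (f (param c u)))] `&`
          [set u | chart_img c u /\ chart_dom d (f (param c u))].
have oU : open U.
  apply: openI; first exact: (open_chart_preimage (Ac _ cA) cgf).
  exact: (open_chart_preimage (Ac _ cA) cf).
exists U; first by [].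
have fC : class_C k U (fun u => Defs.coord d (f (param c u))).
  by apply: class_C_sub (sf c d cA dA k) => u [].
have gC := sg d c' dA cA' k.
apply: (class_C_congr oU); last first.
  apply: (class_C_comp oU _ fC gC) => u [[_ c'u] [_ du]] /=.
  by rewrite dK//; split => //; exists (f (param c u)).
by move=> u; rewrite inE => -[_ [_ du]]; rewrite dK.
Qed.

Lemma smooth_map_pairr E E' F (T T' S : topologicalType) (A : set (chart E T))
    (A' : set (chart E' T')) (B : set (chart F S)) (f : T * T' -> S) (b : T') :
  (forall c, A' c -> is_chart c) -> (forall x, exists2 c, A' c & chart_dom c x) ->
  smooth_map (prod_atlas A A') B f -> smooth_map A B (fun x => f (x, b)).
Proof.
move=> A'c A'cov [cf sf]; split=> [x|c c' cA cB k].
  apply: (@continuous_comp _ _ _ (fun x => (x, b)) f); last exact: cf.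
  by apply: cvg_pair; [exact: cvg_id|exact: cvg_cst].
have [d dA db] := A'cov b; have [_ _ dK _ _] := A'c _ dA.
pose cd := Chart (chart_dom c `*` chart_dom d)
  (fun x => (Defs.coord c x.1, Defs.coord d x.2)) (fun u => (param c u.1, param d u.2)).
have cdA : prod_atlas A A' cd by exists c, d.
have dpair u : is_diff u (fun u : E => (u, Defs.coord d b)) (fun u => (u, 0)).
  exact: (@is_diff_pair _ _ _ _ id id (cst (Defs.coord d b)) (cst 0)).
have lin (h : R) (u v : E) :
    (h *: v + u, Defs.coord d b) = h *: (v, 0 : E') + (u, Defs.coord d b).
  by apply: injective_projections => //=; rewrite scaler0 add0r.
have := class_C_affine dpair lin (sf cd c' cdA cB k).
rewrite /= dK//; apply: class_C_sub => u [[x cx xu] c'u] /=.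
rewrite dK //; split=> //; exists (x, b) => //=.
by rewrite -xu.
Qed.

Lemma smooth_map_pairl E E' F (T T' S : topologicalType) (A : set (chart E T))
    (A' : set (chart E' T')) (B : set (chart F S)) (f : T * T' -> S) (a : T) :
  (forall c, A c -> is_chart c) -> (forall x, exists2 c, A c & chart_dom c x) ->
  smooth_map (prod_atlas A A') B f -> smooth_map A' B (fun y => f (a, y)).
Proof.
move=> Ac Acov [cf sf]; split=> [x|c c' cA cB k].
  apply: (@continuous_comp _ _ _ (fun x => (a, x)) f); last exact: cf.
  by apply: cvg_pair; [exact: cvg_cst|exact: cvg_id].
have [d dA da] := Acov a; have [_ _ dK _ _] := Ac _ dA.
pose dc := Chart (chart_dom d `*` chart_dom c)
  (fun x => (Defs.coord d x.1, Defs.coord c x.2)) (fun u => (param d u.1, param c u.2)).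
have cdA : prod_atlas A A' dc by exists d, c.
have dpair u : is_diff u (fun u : E' => (Defs.coord d a, u)) (fun u => (0, u)).
  exact: (@is_diff_pair _ _ _ _ (cst (Defs.coord d a)) (cst 0) id id).
have lin (h : R) (u v : E') :
    (Defs.coord d a, h *: v + u) = h *: (0 : E, v) + (Defs.coord d a, u).
  by apply: injective_projections => //=; rewrite scaler0 add0r.
have := class_C_affine dpair lin (sf dc c' cdA cB k).
rewrite /= dK//; apply: class_C_sub => u [[x cx xu] c'u] /=.
rewrite dK //; split=> //; exists (a, x) => //=.
by rewrite -xu.
Qed.

Lemma smooth_fun_comp m n (M : manifoldType R m) (N : manifoldType R n)
    (f : N -> R) (g : M -> N) :
  smooth_map (@atlas R m M) (@atlas R n N) g -> smooth_fun f ->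
  smooth_fun (fun x => f (g x)).
Proof.
move=> sg sf; apply: (smooth_map_comp _ _ sg sf); first exact: atlas_chart.
exact: vect_atlas_chart.
Qed.

Lemma smooth_fun_linear n (M : manifoldType R n) (a : R) (f g : M -> R) :
  smooth_fun f -> smooth_fun g -> smooth_fun (fun x => a * f x + g x).
Proof.
move=> [cf sf] [cg sg]; split=> [x|c c' cA -> k /=].
  apply: (@continuousD _ _ _ (fun x => a * f x) g); last exact: cg.
  by apply: (@continuousM _ _ (cst a) f); [exact: cst_continuous|exact: cf].
have oU : open [set u | chart_img c u /\ [set: R] (f (param c u))].
  by apply: (open_chart_preimage (atlas_chart _ cA) cf); exact: openT.
have oU' : open [set u | chart_img c u /\ [set: R] (g (param c u))].
  by apply: (open_chart_preimage (atlas_chart _ cA) cg); exact: openT.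
apply: class_CD => //.
  apply: (class_C_scale oU); first exact: class_C_cst.
  exact: (sf _ (Chart setT id id) cA erefl k).
exact: (sg _ (Chart setT id id) cA erefl k).
Qed.

Lemma smooth_funM n (M : manifoldType R n) (f g : M -> R) :
  smooth_fun f -> smooth_fun g -> smooth_fun (fun x => f x * g x).
Proof.
move=> [cf sf] [cg sg]; split=> [x|c c' cA -> k /=].
  by apply: (@continuousM _ _ f g); [exact: cf|exact: cg].
have oU : open [set u | chart_img c u /\ [set: R] (f (param c u))].
  by apply: (open_chart_preimage (atlas_chart _ cA) cf); exact: openT.
apply: (class_C_scale oU).
  exact: (sf _ (Chart setT id id) cA erefl k).
exact: (sg _ (Chart setT id id) cA erefl k).
Qed.

Lemma smooth_map_derivable (f : R -> R) t :
  smooth_map (@vect_atlas R R) (@vect_atlas R R) f -> derivable f t 1.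
Proof.
move=> [_ /(_ (Chart setT id id) (Chart setT id id) erefl erefl 1%N) [df _]].
by apply/diff_derivable/df; split => //; exists t.
Qed.

End SmoothMaps.

Section LieGroups.
Variables (R : realType) (m n : nat) (G : lieGroupType R m)
  (N : manifoldType R n) (act : G -> N -> N).

Lemma smooth_mulg (a : G) :
  smooth_map (@atlas R m G) (@atlas R m G) (fun g => (a * g)%g).
Proof.
apply: (smooth_map_pairl a _ _ lie_mul_smooth); first exact: atlas_chart.
exact: atlas_cover.
Qed.

Lemma smooth_act (h : G) : smooth_action act ->
  smooth_map (@atlas R n N) (@atlas R n N) (act h).
Proof.
move=> [_ _ sa].
apply: (smooth_map_pairl h _ _ sa); first exact: atlas_chart.
exact: atlas_cover.
Qed.

Lemma smooth_orbit (x : N) : smooth_action act ->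
  smooth_map (@atlas R m G) (@atlas R n N) (act ^~ x).
Proof.
move=> [_ _ sa].
apply: (smooth_map_pairr x _ _ sa); first exact: atlas_chart.
exact: atlas_cover.
Qed.

Definition log_velocity (c : R -> G) (t : R) : (G -> R) -> R :=
  fun h => if `[< smooth_fun h >]
           then derive1 (fun s : R => h ((c t)^-1 * c s)%g) t else 0.

Lemma log_velocity_derivable (c : R -> G) (t : R) (h : G -> R) :
  smooth_curve c -> smooth_fun h ->
  derivable (fun s : R => h ((c t)^-1 * c s)%g) t 1.
Proof.
move=> sc sh; apply: smooth_map_derivable.
apply: (smooth_map_comp _ _ sc (smooth_fun_comp (smooth_mulg (c t)^-1%g) sh));
  exact: vect_atlas_chart.
Qed.

Lemma log_velocity_tangent (c : R -> G) (t : R) :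
  smooth_curve c -> is_tangent (1%g : G) (log_velocity c t).
Proof.
move=> sc; rewrite /log_velocity.
have df f sf := @log_velocity_derivable c t f sc sf.
split=> [f /asboolPn/negbTE ->//|a f g sf sg|f g sf sg].
  rewrite !asboolT//; last exact: smooth_fun_linear.
  have := deriveD (derivableZ (k := a) (df f sf)) (df g sg).
  by rewrite deriveZ ?derive1E//; exact: df.
rewrite !asboolT//; last exact: smooth_funM.
have := deriveM (df f sf) (df g sg).
rewrite !derive1E => -> /=.
by rewrite mulVg addrC [X in X + _]mulrC.
Qed.

Lemma tangentZ (p : G) (a : R) (v : (G -> R) -> R) :
  is_tangent p v -> is_tangent p (a *: v).
Proof.
move=> [v0 vD vM]; split=> [f nf|b f g sf sg|f g sf sg]; rewrite !fctE.
- by rewrite v0// scaler0.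
- by rewrite vD// scalerDr /GRing.scale/= mulrCA.
- by rewrite vM// scalerDr /GRing.scale/= mulrA mulrCA.
Qed.

Lemma fundamentalZ (a : R) (v : (G -> R) -> R) :
  fundamental act (a *: v) = a *: fundamental act v.
Proof.
apply/funext => f; apply/funext => x; rewrite /fundamental !fctE.
by case: ifP => // _; rewrite scaler0.
Qed.

(* The velocity (dc/dt) o c^-1 is the push-forward by c_t of the fundamental
   field of c^-1 dc/dt. *)
Lemma gstarE (c : R -> G) (X : R -> (N -> R) -> (N -> R)) (t : R) :
  smooth_action act ->
  gstar act c X t =
  vf_pushforward act (c t) (fundamental act (log_velocity c t) + X t).
Proof.
move=> sact; have [act1 actM _] := sact.
apply/funext => f; apply/funext => x.
rewrite /gstar /vf_pushforward !fctE; congr (_ + _).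
rewrite /curve_velocity /fundamental /log_velocity.
have [sf|nsf] := asboolP (smooth_fun f); last first.
  case: asboolP => // sft; exfalso; apply: nsf.
  have := smooth_fun_comp (smooth_act (c t)^-1%g sact) sft.
  suff -> : (fun y => f (act (c t) (act (c t)^-1%g y))) = f by [].
  by apply/funext => y; rewrite -actM mulgV act1.
have sft := smooth_fun_comp (smooth_act (c t) sact) sf.
rewrite !asboolT//; last exact: (smooth_fun_comp (smooth_orbit _ sact) sft).
by congr derive1; apply/funext => s; rewrite -(actM (c t)) mulVKg.
Qed.

Lemma vf_pushforward_eq0 (h : G) (Y : (N -> R) -> (N -> R)) :
  smooth_action act -> vf_pushforward act h Y = 0 -> Y = 0.
Proof.
move=> [act1 actM _] Y0; apply/funext => k; apply/funext => y.
have := congr1 (fun Z => Z (fun z => k (act h^-1%g z)) (act h y)) Y0.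
rewrite /vf_pushforward -actM mulVg act1 => Yk; rewrite -[RHS]Yk; congr (Y _ _).
by apply/funext => z; rewrite -actM mulVg act1.
Qed.

End LieGroups.

Section Groups.
Variables (R : realType) (m1 m2 : nat)
  (G1 : lieGroupType R m1) (G2 : lieGroupType R m2) (Phi : G1 -> G2).

Lemma morph_mulVg (PhiM : forall g h, Phi (g * h)%g = (Phi g * Phi h)%g) g h :
  Phi (g^-1 * h)%g = ((Phi g)^-1 * Phi h)%g.
Proof. by apply: (mulgI (Phi g)); rewrite -PhiM !mulVKg. Qed.

(* Differentiating Phi (exp1 (s v)) = exp2 (s w) at s = 0. *)
Lemma diff_induced n1 n2 (N1 : manifoldType R n1) (N2 : manifoldType R n2)
    (act1 : G1 -> N1 -> N1) (act2 : G2 -> N2 -> N2)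
    (exp1 : ((G1 -> R) -> R) -> G1) (exp2 : ((G2 -> R) -> R) -> G2)
    (phi : ((N1 -> R) -> (N1 -> R)) -> ((N2 -> R) -> (N2 -> R))) v w :
  exponential_map exp1 -> exponential_map exp2 ->
  induced_epimorphism act1 act2 exp1 exp2 phi Phi ->
  (forall s : R, phi (s *: fundamental act1 v) = s *: phi (fundamental act1 v)) ->
  is_tangent (1%g : G1) v -> is_tangent (1%g : G2) w ->
  fundamental act2 w = phi (fundamental act1 v) ->
  forall h, smooth_fun h -> w h = v (fun g => h (Phi g)).
Proof.
move=> hexp1 hexp2 [sPhi _ _ Phiexp] phiZ tv tw vw h sh.
have [_ _ <-//] := hexp2 _ tw.
have [_ _ <-//] := hexp1 _ tv; last exact: smooth_fun_comp.
congr derive1; apply/funext => s; congr h.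
apply/esym/Phiexp; [exact: tangentZ|exact: tangentZ|].
by rewrite !fundamentalZ vw phiZ.
Qed.

End Groups.

Theorem theorem6p3 (R : realType) (n1 n2 m1 m2 : nat)
    (N1 : manifoldType R n1) (N2 : manifoldType R n2)
    (W1 V1 : set ((N1 -> R) -> (N1 -> R)))
    (W2 V2 : set ((N2 -> R) -> (N2 -> R)))
    (G1 : lieGroupType R m1) (G2 : lieGroupType R m2)
    (act1 : G1 -> N1 -> N1) (act2 : G2 -> N2 -> N2)
    (exp1 : ((G1 -> R) -> R) -> G1) (exp2 : ((G2 -> R) -> R) -> G2)
    (phi : ((N1 -> R) -> (N1 -> R)) -> ((N2 -> R) -> (N2 -> R)))
    (Phi : G1 -> G2)
    (hS1 : quasi_lie_scheme W1 V1)
    (hS2 : quasi_lie_scheme W2 V2)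
    (hG1 : scheme_action act1 W1)
    (hG2 : scheme_action act2 W2)
    (hexp1 : exponential_map exp1)
    (hexp2 : exponential_map exp2)
    (hphi : algebraic_epimorphism W1 V1 W2 V2 phi)
    (hPhi : induced_epimorphism act1 act2 exp1 exp2 phi Phi)
    (X : R -> (N1 -> R) -> (N1 -> R))
    (hX : tdep_vfield V1 X)
    (g1 : R -> G1)
    (hg1 : smooth_curve g1)
    (hgX : gstar act1 g1 X = (fun _ => 0)) :
  gstar act2 (fun t => Phi (g1 t)) (fun t => phi (X t)) = (fun _ => 0).
Proof.
have [_ sact1 [fund1W _ _]] := hG1; have [_ sact2 [_ _ fund2W]] := hG2.
have [_ WV1 _ _] := hS1.
have [[_ phiL _ phiW] _ _] := hphi.
have [sPhi PhiM _ _] := hPhi.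
apply/funext => t; rewrite gstarE//.
set v := log_velocity g1 t.
have tv : is_tangent (1%g : G1) v by exact: log_velocity_tangent.
have V1v : V1 (fundamental act1 v) by apply/WV1/fund1W.
have V10 : V1 0.
  case: hS1 => -[_ [_ [d [e ->]]]] _ _ _; exists (fun=> 0) => //.
  by rewrite big1// => i _; rewrite scale0r.
have phi0 : phi 0 = 0.
  have := phiL 1 0 0 V10 V10; rewrite !scale1r addr0.
  by move=> /(congr1 (fun Z => Z - phi 0)); rewrite addrK subrr.
have phiZ (s : R) : phi (s *: fundamental act1 v) = s *: phi (fundamental act1 v).
  by have := phiL s _ 0 V1v V10; rewrite phi0 !addr0.
have Xt : X t = - fundamental act1 v.
  apply/eqP; rewrite -addr_eq0 addrC; apply/eqP.
  apply: (vf_pushforward_eq0 (act := act1) (h := g1 t)) => //.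
  by rewrite -gstarE// hgX.
have /fund2W[w tw wE] : W2 (phi (fundamental act1 v)).
  by apply: phiW; exists (fundamental act1 v) => //; exact: fund1W.
have wv : log_velocity (fun s => Phi (g1 s)) t = w.
  apply/funext => h; rewrite /log_velocity; case: asboolP => [sh|nsh]; last first.
    by case: tw => ->.
  rewrite (diff_induced hexp1 hexp2 hPhi phiZ tv tw wE sh).
  rewrite /v /log_velocity asboolT; last exact: smooth_fun_comp.
  by congr derive1; apply/funext => s; rewrite morph_mulVg.
rewrite wv wE Xt -scaleN1r phiZ scaleN1r addrN.
by apply/funext => f; apply/funext => x.
Qed.
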